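(* Let $G_1:\mathbf{L}_{1e}^m\to\mathbf{L}_{1e}^p$ be a (possibly nonlinear) bounded causal operator and let $G_2:\mathbf{L}_{1e}^p\to\mathbf{L}_{1e}^m$ be a linear bounded causal operator. Suppose there exists $\Pi\in\mathbb{R}^{1\times(m+p)}$ such that (i) $[\tau G_1,G_2]$ is well-posed and positive for all $\tau\in[0,1]$; (ii) $\tau G_1\in\mathrm{ILC}(\Pi)$ for all $\tau\in[0,1]$; and (iii) $G_2\in\mathrm{ILC}^c(\Pi)$. Then $[G_1,G_2]$ is stable on $\mathbf{L}_{1e+}$. If, in addition, $G_1$ is also linear, then $[G_1,G_2]$ is stable.
   Context: Let $|\cdot|$ be the 1-norm on $\mathbb{R}^n$ and $\mathbb{R}^n_+$ the nonnegative orthant. $\mathbf{L}_1^n$ is the set of (classes of) measurable $v:[0,\infty)\to\mathbb{R}^n$ with $\|v\|_1 := \int_0^\infty |v(t)|\,dt<\infty$, and $\mathbf{L}_{1+}^n := \{v\in\mathbf{L}_1^n : v(t)\in\mathbb{R}^n_+ \text{ a.e.}\}$. The truncation operator is $(P_Tv)(t) := v(t)$ for $t\in[0,T)$ and $0$ otherwise. The extended spaces are $\mathbf{L}_{1e}^n := \{v:[0,\infty)\to\mathbb{R}^n : P_Tv\in\mathbf{L}_1^n\ \forall T\in[0,\infty)\}$ and $\mathbf{L}_{1e+}^n := \{v:[0,\infty)\to\mathbb{R}^n : P_Tv\in\mathbf{L}_{1+}^n\ \forall T\in[0,\infty)\}$. Superscripts are dropped when dimensions are clear. An operator $\Delta:\mathbf{L}_{1e}\to\mathbf{L}_{1e}$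 is causal if $P_T\Delta P_T=P_T\Delta$ for all $T\ge0$. A causal $\Delta$ is bounded if $\|\Delta\| := \sup_{x\in\mathbf{L}_{1e};\,T>0;\,\|P_Tx\|_1\ne0}\|P_T\Delta x\|_1/\|P_Tx\|_1<\infty$. $\Delta$ is monotone if $u_1\ge u_2$ implies $\Delta u_1\ge\Delta u_2$ for all $u_1,u_2\in\mathbf{L}_{1e}$ (coordinate-wise inequalities, a.e. in time). $\Delta$ is positive if it is monotone and $\Delta0=0$ (in particular $\Delta\mathbf{L}_{1e+}\subset\mathbf{L}_{1e+}$; for linear $\Delta$ positivity is equivalent to $\Delta\mathbf{L}_{1e+}\subset\mathbf{L}_{1e+}$). A positive $\Delta$ is bounded on $\mathbf{L}_{1e+}$ if $\|\Delta\|_+ := \sup_{x\in\mathbf{L}_{1e+};\,T>0;\,\|P_Tx\|_1\ne0}\|P_T\Delta x\|_1/\|P_Tx\|_1<\infty$. The (positive) feedback interconnection $[G_1,G_2]$ is given by $u_2=G_1u_1+d_2$, $u_1=G_2u_2+d_1$, where $u_1,d_1\in\mathbf{L}_{1e}^m$ and $u_2,d_2\in\mathbf{L}_{1e}^p$. It is well-posed if the map $(u_1,u_2)\mapsto(d_1,d_2)$ defined by these equations has a causal inverse $H$ on $\mathbf{L}_{1e}$; positive if it is well-posed and $H$ is positive; stable on $\mathbf{L}_{1e+}$ if it is well-posed, positive, and $H$ is bounded on $\mathbf{L}_{1e+}$; stable if it is well-posed and $H$ is bounded. For a causal bounded $\Delta$, the graph and inverse graph with respect to positive signals are $\mathcal{G}(\Delta)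 := \{\begin{bmatrix} x \\ y \end{bmatrix}\in\mathbf{L}_{1+} : y=\Delta x\}$ and $\mathcal{G}'(\Delta) := \{\begin{bmatrix} y \\ x \end{bmatrix}\in\mathbf{L}_{1+} : y=\Delta x\}$ (i.e. in $\mathcal{G}'$ the output is listed first and the input second). Let $\Pi$ be a real row vector of length $m+p$. $\Delta\in\mathrm{ILC}(\Pi)$ means $\int_0^\infty\Pi v(t)\,dt\ge0$ for all $v\in\mathcal{G}(\Delta)$. $\Delta\in\mathrm{ILC}^c(\Pi)$ means that for some $\epsilon>0$, $\int_0^\infty\Pi w(t)\,dt\le-\epsilon\int_0^\infty 1_{p+m}^Tw(t)\,dt$ for all $w\in\mathcal{G}'(\Delta)$, where $1_n\in\mathbb{R}^n$ is the all-ones vector. *)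

(* Defs.v *)
From HB Require Import structures.
From mathcomp Require Import all_boot all_order all_algebra.
From mathcomp Require Import all_classical all_reals all_analysis.

Set Implicit Arguments.
Unset Strict Implicit.
Unset Printing Implicit Defensive.

Import Order.TTheory GRing.Theory Num.Theory.
Import numFieldNormedType.Exports.

Local Open Scope classical_set_scope.
Local Open Scope ring_scope.

(* Signals are functions on the whole of R, of which only the restriction to
   the time axis [0, +oo[ matters. The classes of the L1 spaces are represented
   by functions considered up to a.e. equality on the time axis. *)
Notation signal R n := (R -> 'cV[R]_n).

Definition time {R : realType} : set R := `[0, +oo[.

Definition sig_eq (R : realType) (n : nat) (u v : signal R n) : Prop :=
  ae_eq (@lebesgue_measure R) time u v.

Definition sig_le (R : realType) (n : nat) (u v : signal R n) : Prop :=
  {ae @lebesgue_measure R, forall t, time t -> forall i, u t i 0 <= v t i 0}.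

Definition vnorm1 (R : realType) (n : nat) (x : 'cV[R]_n) : R :=
  \sum_(i < n) `|x i 0|.

Definition norm1 (R : realType) (n : nat) (v : signal R n) : \bar R :=
  (\int[@lebesgue_measure R]_(t in time) (vnorm1 (v t))%:E)%E.

Definition L1 (R : realType) (n : nat) : set (signal R n) :=
  [set v : signal R n | (forall i, measurable_fun time (fun t => v t i 0))
           /\ (norm1 v < +oo)%E].

Definition L1p (R : realType) (n : nat) : set (signal R n) :=
  [set v : signal R n | L1 v /\ sig_le 0 v].

Definition trunc (R : realType) (n : nat) (T : R) (v : signal R n) :
    signal R n :=
  fun t => if 0 <= t < T then v t else 0.

Definition L1e (R : realType) (n : nat) : set (signal R n) :=
  [set v : signal R n | forall T, 0 <= T -> L1 (trunc T v)].

Definition L1ep (R : realType) (n : nat) : set (signal R n) :=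
  [set v : signal R n | forall T, 0 <= T -> L1p (trunc T v)].

(* D induces a map from (classes of) L1e^n to (classes of) L1e^k. *)
Definition l1e_operator (R : realType) (n k : nat)
    (D : signal R n -> signal R k) : Prop :=
  (forall v, L1e v -> L1e (D v)) /\
  (forall u v, L1e u -> L1e v -> sig_eq u v -> sig_eq (D u) (D v)).

Definition causal (R : realType) (n k : nat)
    (D : signal R n -> signal R k) : Prop :=
  forall T v, 0 <= T -> L1e v ->
    sig_eq (trunc T (D (trunc T v))) (trunc T (D v)).

Definition linear_operator (R : realType) (n k : nat)
    (D : signal R n -> signal R k) : Prop :=
  forall (a : R) u v, L1e u -> L1e v ->
    sig_eq (D (a *: u + v)) (a *: D u + D v).

(* On extended signals the truncated norms are finite, so that [fine] does not
   lose information. *)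
Definition gain_on (R : realType) (n k : nat) (X : set (signal R n))
    (D : signal R n -> signal R k) : \bar R :=
  ereal_sup [set r : \bar R | exists (x : signal R n) (T : R),
    [/\ X x, 0 < T, norm1 (trunc T x) <> 0%E &
        r = (fine (norm1 (trunc T (D x))) / fine (norm1 (trunc T x)))%:E]].

Definition bounded_operator (R : realType) (n k : nat)
    (D : signal R n -> signal R k) : Prop :=
  (gain_on (@L1e R n) D < +oo)%E.

Definition pos_bounded_operator (R : realType) (n k : nat)
    (D : signal R n -> signal R k) : Prop :=
  (gain_on (@L1ep R n) D < +oo)%E.

Definition monotone_operator (R : realType) (n k : nat)
    (D : signal R n -> signal R k) : Prop :=
  forall u v, L1e u -> L1e v -> sig_le v u -> sig_le (D v) (D u).

Definition positive_operator (R : realType) (n k : nat)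
    (D : signal R n -> signal R k) : Prop :=
  monotone_operator D /\ sig_eq (D 0) 0.

Definition usig (R : realType) (n k : nat) (v : signal R (n + k)) :
    signal R n := fun t => usubmx (v t).

Definition dsig (R : realType) (n k : nat) (v : signal R (n + k)) :
    signal R k := fun t => dsubmx (v t).

Definition col_sig (R : realType) (n k : nat) (x : signal R n)
    (y : signal R k) : signal R (n + k) := fun t => col_mx (x t) (y t).

(* The map (u1, u2) |-> (d1, d2) determined by the loop equations
   u2 = G1 u1 + d2 and u1 = G2 u2 + d1. *)
Definition loop_map (R : realType) (m p : nat)
    (G1 : signal R m -> signal R p) (G2 : signal R p -> signal R m)
    (u : signal R (m + p)) : signal R (m + p) :=
  col_sig (usig u - G2 (dsig u)) (dsig u - G1 (usig u)).

(* Such an H is unique up to a.e. equality. *)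
Definition loop_inverse (R : realType) (m p : nat)
    (G1 : signal R m -> signal R p) (G2 : signal R p -> signal R m)
    (H : signal R (m + p) -> signal R (m + p)) : Prop :=
  [/\ l1e_operator H, causal H,
      forall u, L1e u -> sig_eq (H (loop_map G1 G2 u)) u &
      forall d, L1e d -> sig_eq (loop_map G1 G2 (H d)) d].

Definition well_posed (R : realType) (m p : nat)
    (G1 : signal R m -> signal R p) (G2 : signal R p -> signal R m) : Prop :=
  exists H, loop_inverse G1 G2 H.

Definition positive_loop (R : realType) (m p : nat)
    (G1 : signal R m -> signal R p) (G2 : signal R p -> signal R m) : Prop :=
  exists H, loop_inverse G1 G2 H /\ positive_operator H.

Definition pos_stable (R : realType) (m p : nat)
    (G1 : signal R m -> signal R p) (G2 : signal R p -> signal R m) : Prop :=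
  exists H, [/\ loop_inverse G1 G2 H, positive_operator H &
                pos_bounded_operator H].

Definition stable (R : realType) (m p : nat)
    (G1 : signal R m -> signal R p) (G2 : signal R p -> signal R m) : Prop :=
  exists H, loop_inverse G1 G2 H /\ bounded_operator H.

Definition pgraph (R : realType) (n k : nat)
    (D : signal R n -> signal R k) : set (signal R (n + k)) :=
  [set v : signal R (n + k) | L1p v /\ sig_eq (dsig v) (D (usig v))].

Definition inv_pgraph (R : realType) (n k : nat)
    (D : signal R n -> signal R k) : set (signal R (k + n)) :=
  [set w : signal R (k + n) | L1p w /\ sig_eq (usig w) (D (dsig w))].

Definition ILC (R : realType) (n k : nat) (Pi : 'rV[R]_(n + k))
    (D : signal R n -> signal R k) : Prop :=
  forall v, pgraph D v ->
    0 <= \int[@lebesgue_measure R]_(t in time) (Pi *m v t) 0 0.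

Definition ILCc (R : realType) (n k : nat) (Pi : 'rV[R]_(k + n))
    (D : signal R n -> signal R k) : Prop :=
  exists2 eps : R, 0 < eps & forall w, inv_pgraph D w ->
    \int[@lebesgue_measure R]_(t in time) (Pi *m w t) 0 0 <=
    - eps * \int[@lebesgue_measure R]_(t in time)
              ((const_mx 1 : 'rV[R]_(k + n)) *m w t) 0 0.

(* Main.v *)
Require Import Defs.
From mathcomp Require Import all_boot all_order all_algebra.
From mathcomp Require Import all_classical all_reals all_analysis.
From mathcomp Require Import measurable_realfun lra.

Import Order.TTheory GRing.Theory Num.Theory.
Import numFieldNormedType.Exports.

Local Open Scope classical_set_scope.
Local Open Scope ring_scope.

(* Everything is stated for a signal [u] and the data [d] of the loop equations
   that [u] solves. If [u] and [d] are integrable and nonnegative, comparing the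
   two conic constraints along [u] gives [|u| <= C |d|] with [C] independent of
   tau. At tau = 0 the loop is open and its solutions are bounded. A bound at
   tau gives one at tau' slightly above tau, since the extra term
   [(tau' - tau) G1 u1] is nonnegative data of small gain relative to [u]; this
   bound makes [u] integrable, hence can be replaced by [C], and finitely many
   steps of equal size lead to tau = 1. When [G1] is linear, the estimate for
   general data follows from [d = (|d| + d) - |d|]. *)

Section signals.
Set Implicit Arguments.
Unset Strict Implicit.
Context {R : realType}.
Notation mu := (@lebesgue_measure R).

Lemma measurable_time : measurable (@time R : set (measurableTypeR R)).
Proof. exact: measurable_itv. Qed.
#[local] Hint Extern 0 (measurable time) => exact: measurable_time : core.

(** * The 1-norm on vectors *)

Lemma vnorm1_ge0 n (x : 'cV[R]_n) : 0 <= vnorm1 x.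
Proof. by apply: sumr_ge0 => i _. Qed.
#[local] Hint Resolve vnorm1_ge0 : core.

Lemma vnorm1D n (x y : 'cV[R]_n) : vnorm1 (x + y) <= vnorm1 x + vnorm1 y.
Proof.
rewrite /vnorm1 -big_split /=; apply: ler_sum => i _.
by rewrite mxE ler_normD.
Qed.

Lemma vnorm1Z n a (x : 'cV[R]_n) : vnorm1 (a *: x) = `|a| * vnorm1 x.
Proof.
by rewrite /vnorm1 mulr_sumr; apply: eq_bigr => i _; rewrite mxE normrM.
Qed.

Lemma vnorm10 n : vnorm1 (0 : 'cV[R]_n) = 0.
Proof. by rewrite /vnorm1 big1 // => i _; rewrite mxE normr0. Qed.

Lemma vnorm1_col_mx n k (x : 'cV[R]_n) (y : 'cV[R]_k) :
  vnorm1 (col_mx x y) = vnorm1 x + vnorm1 y.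
Proof.
rewrite /vnorm1 big_split_ord; congr (_ + _).
  by apply: eq_bigr => i _; rewrite col_mxEu.
by apply: eq_bigr => i _; rewrite col_mxEd.
Qed.

Lemma ler_vnorm1 n (x : 'cV[R]_n) i : `|x i 0| <= vnorm1 x.
Proof. by rewrite /vnorm1 (bigD1 i) //= lerDl sumr_ge0. Qed.

Lemma vnorm1_eq0 n (x : 'cV[R]_n) : vnorm1 x = 0 -> x = 0.
Proof.
move=> x0; apply/colP => i; rewrite !mxE; apply/eqP.
by rewrite -normr_le0 -x0 ler_vnorm1.
Qed.

Lemma measurable_vnorm1 n (v : signal R n) :
  (forall i, measurable_fun time (fun t => v t i 0)) ->
  measurable_fun time (fun t => vnorm1 (v t)).
Proof.
move=> mv; apply: measurable_sum => i.
by apply: measurableT_comp => //; exact: mv.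
Qed.

(** * Integrable signals and their closure properties *)

Lemma L1_measurable n (v : signal R n) i :
  L1 v -> measurable_fun time (fun t => v t i 0).
Proof. by case=> + _; exact. Qed.

Lemma L1_integrable_vnorm1 n (v : signal R n) :
  L1 v -> mu.-integrable time (EFin \o (fun t => vnorm1 (v t))).
Proof.
move=> [mv fv]; apply/integrableP; split.
  by apply/measurable_EFinP; exact: measurable_vnorm1.
rewrite [ltLHS](_ : _ = norm1 v) //.
by apply: eq_integral => t _ /=; rewrite ger0_norm.
Qed.

(** Each entry is dominated by the 1-norm, and the 1-norm is a finite sum of absolute entries.
    Closure properties of [L1] thereby reduce to scalar integrability. *)
Lemma L1P n (v : signal R n) :
  L1 v <-> forall i, mu.-integrable time (EFin \o (fun t => v t i 0)).
Proof.
split=> [Lv i|iv].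
  apply: le_integrable (L1_integrable_vnorm1 Lv) => //.
    by apply/measurable_EFinP; exact: L1_measurable.
  by move=> t _ /=; rewrite lee_fin (ger0_norm (vnorm1_ge0 _)) ler_vnorm1.
have mv i : measurable_fun time (fun t => v t i 0).
  by apply/measurable_EFinP; exact: measurable_int (iv i).
split=> //.
have : mu.-integrable time (EFin \o (fun t => vnorm1 (v t))).
  have -> : EFin \o (fun t => vnorm1 (v t)) =
      (fun t => \sum_(i <- index_enum 'I_n) `|(v t i 0)%:E|%E)%E.
    by apply/funext => t /=; rewrite /vnorm1 sumEFin.
  by apply: integrable_sum => // i _; exact: integrable_abse (iv i).
move/integrableP => [_]; rewrite [ltLHS](_ : _ = norm1 v) //.
by apply: eq_integral => t _ /=; rewrite ger0_norm.
Qed.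

Lemma L1D n (u v : signal R n) : L1 u -> L1 v -> L1 (u + v).
Proof.
move=> /L1P Lu /L1P Lv; apply/L1P => i.
have := integrableD measurable_time (Lu i) (Lv i).
by apply: eq_integrable => // t _ /=; rewrite mxE.
Qed.

Lemma L1Z n a (u : signal R n) : L1 u -> L1 (a *: u).
Proof.
move=> /L1P Lu; apply/L1P => i.
have := integrableZl measurable_time a (Lu i).
by apply: eq_integrable => // t _ /=; rewrite mxE.
Qed.

Lemma L1B n (u v : signal R n) : L1 u -> L1 v -> L1 (u - v).
Proof. by move=> Lu Lv; rewrite -scaleN1r; apply: L1D => //; apply: L1Z. Qed.

Lemma L10 n : L1 (0 : signal R n).
Proof.
apply/L1P => i; apply: eq_integrable (integrable0 _ _) => // t _ /=.
by rewrite mxE.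
Qed.

Lemma L1_col n k (x : signal R n) (y : signal R k) :
  L1 x -> L1 y -> L1 (col_sig x y).
Proof.
move=> /L1P Lx /L1P Ly; apply/L1P => i.
rewrite -(splitK i); case: (fintype.split i) => j /=.
  by apply: eq_integrable (Lx j) => // t _ /=; rewrite col_mxEu.
by apply: eq_integrable (Ly j) => // t _ /=; rewrite col_mxEd.
Qed.

Lemma L1_usig n k (v : signal R (n + k)) : L1 v -> L1 (usig v).
Proof.
move=> /L1P Lv; apply/L1P => i.
by apply: eq_integrable (Lv (lshift k i)) => // t _ /=; rewrite mxE.
Qed.

Lemma L1_dsig n k (v : signal R (n + k)) : L1 v -> L1 (dsig v).
Proof.
move=> /L1P Lv; apply/L1P => i.
by apply: eq_integrable (Lv (rshift n i)) => // t _ /=; rewrite mxE.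
Qed.

Lemma L1_absv n (v : signal R n) :
  L1 v -> L1 (fun t => map_mx Num.norm (v t)).
Proof.
move=> /L1P Lv; apply/L1P => i.
by apply: eq_integrable (integrable_abse (Lv i)) => // t _ /=; rewrite mxE.
Qed.

Lemma vnorm1_trunc n T (v : signal R n) t :
  vnorm1 (trunc T v t) <= vnorm1 (v t).
Proof. by rewrite /trunc; case: ifP => // _; rewrite vnorm10. Qed.

Lemma L1_trunc n T (v : signal R n) : L1 v -> L1 (trunc T v).
Proof.
move=> /L1P Lv; apply/L1P => i; apply: le_integrable (Lv i) => //; last first.
  move=> t _ /=; rewrite lee_fin /trunc; case: ifP => // _.
  by rewrite mxE normr0.
apply/measurable_EFinP.
(* Measurability is read off from truncation as multiplication by the indicator of [[0, T[]. *)
have -> : (fun t => trunc T v t i 0) =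
    (fun t => \1_(`[0, T[%classic : set R) t * v t i 0).
  apply/funext => t; rewrite /trunc indicE.
  rewrite (_ : (t \in _) = (0 <= t < T)); last first.
    by rewrite mem_setE in_itv.
  by case: ifP; rewrite ?mul1r // mul0r mxE.
apply: measurable_funM.
  by apply: measurable_funTS; exact: measurable_indic.
by apply/measurable_EFinP; exact: measurable_int (Lv i).
Qed.

Lemma L1_L1e n (v : signal R n) : L1 v -> L1e v.
Proof. by move=> Lv T _; exact: L1_trunc. Qed.

(** * The real-valued norm of integrable signals *)

(* [fine] sends an infinite [norm1] to 0, so this is a norm on [L1] only. *)
Definition nrm {n} (v : signal R n) : R := fine (norm1 v).

Lemma nrmE n (v : signal R n) : nrm v = \int[mu]_(t in time) vnorm1 (v t).
Proof. by []. Qed.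

Lemma nrm_ge0 n (v : signal R n) : 0 <= nrm v.
Proof. by apply: Rintegral_ge0 => t _. Qed.

Lemma norm1E n (v : signal R n) : L1 v -> norm1 v = (nrm v)%:E.
Proof.
move=> [_ fv]; rewrite /nrm fineK // ge0_fin_numE //.
by apply: integral_ge0 => t _; rewrite lee_fin.
Qed.

Lemma le_nrm n k (u : signal R n) (v : signal R k) : L1 u -> L1 v ->
  (forall t, vnorm1 (u t) <= vnorm1 (v t)) -> nrm u <= nrm v.
Proof.
move=> Lu Lv uv; apply: le_Rintegral => //; exact: L1_integrable_vnorm1.
Qed.

Lemma nrmD n (u v : signal R n) : L1 u -> L1 v -> nrm (u + v) <= nrm u + nrm v.
Proof.
move=> Lu Lv; rewrite !nrmE -RintegralD //; last first.
- exact: L1_integrable_vnorm1.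
- exact: L1_integrable_vnorm1.
apply: le_Rintegral => //.
- by apply: L1_integrable_vnorm1; exact: L1D.
- apply: eq_integrable (integrableD measurable_time
    (L1_integrable_vnorm1 Lu) (L1_integrable_vnorm1 Lv)) => //.
- by move=> t _; exact: vnorm1D.
Qed.

Lemma nrmZ n a (u : signal R n) : L1 u -> nrm (a *: u) = `|a| * nrm u.
Proof.
move=> Lu; rewrite !nrmE -RintegralZl //; last exact: L1_integrable_vnorm1.
by apply: eq_Rintegral => t _; rewrite vnorm1Z.
Qed.

Lemma nrmN n (u : signal R n) : nrm (- u) = nrm u.
Proof.
rewrite !nrmE; apply: eq_Rintegral => t _.
by rewrite fctE -scaleN1r vnorm1Z normrN1 mul1r.
Qed.

Lemma nrmB n (u v : signal R n) : L1 u -> L1 v -> nrm (u - v) <= nrm u + nrm v.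
Proof.
move=> Lu Lv; rewrite -(nrmN v); apply: nrmD => //.
by rewrite -scaleN1r; exact: L1Z.
Qed.

Lemma nrm0 n : nrm (0 : signal R n) = 0.
Proof. by rewrite -(scale0r 0) nrmZ ?normr0 ?mul0r//; exact: L10. Qed.

Lemma nrm_col n k (x : signal R n) (y : signal R k) :
  L1 x -> L1 y -> nrm (col_sig x y) = nrm x + nrm y.
Proof.
move=> Lx Ly; rewrite !nrmE -RintegralD //; last first.
- exact: L1_integrable_vnorm1.
- exact: L1_integrable_vnorm1.
by apply: eq_Rintegral => t _; rewrite vnorm1_col_mx.
Qed.

(** * Equality almost everywhere *)

Lemma sig_eq_refl n (u : signal R n) : sig_eq u u.
Proof. exact: ae_eq_refl. Qed.

Lemma sig_eq_sym n (u v : signal R n) : sig_eq u v -> sig_eq v u.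
Proof. exact: ae_eq_sym. Qed.

Lemma sig_eq_trans n (v u w : signal R n) :
  sig_eq u v -> sig_eq v w -> sig_eq u w.
Proof. exact: ae_eq_trans. Qed.

(** [F] may depend on time, so that truncation is covered along with the pointwise algebraic
    operations. *)
Lemma sig_eq_pointwise n k (F : R -> 'cV[R]_n -> 'cV[R]_k) (u v : signal R n) :
  sig_eq u v -> sig_eq (fun t => F t (u t)) (fun t => F t (v t)).
Proof. by apply: filterS => t /[apply] ->. Qed.

Lemma sig_eq_trunc n T (u v : signal R n) :
  sig_eq u v -> sig_eq (trunc T u) (trunc T v).
Proof. exact: (sig_eq_pointwise (fun t x => if 0 <= t < T then x else 0)). Qed.

Lemma sig_eq_usig n k (u v : signal R (n + k)) :
  sig_eq u v -> sig_eq (usig u) (usig v).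
Proof. exact: (sig_eq_pointwise (fun=> usubmx)). Qed.

Lemma sig_eq_dsig n k (u v : signal R (n + k)) :
  sig_eq u v -> sig_eq (dsig u) (dsig v).
Proof. exact: (sig_eq_pointwise (fun=> dsubmx)). Qed.

Lemma sig_eqZ n a (u v : signal R n) : sig_eq u v -> sig_eq (a *: u) (a *: v).
Proof. exact: (sig_eq_pointwise (fun=> *:%R a)). Qed.

Lemma sig_eqB n (u u' v v' : signal R n) :
  sig_eq u u' -> sig_eq v v' -> sig_eq (u - v) (u' - v').
Proof. by apply: filterS2 => t uu vv tt; rewrite !fctE uu // vv. Qed.

Lemma sig_eq_col n k (x x' : signal R n) (y y' : signal R k) :
  sig_eq x x' -> sig_eq y y' -> sig_eq (col_sig x y) (col_sig x' y').
Proof.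
by apply: filterS2 => t xx yy tt; rewrite /col_sig xx // yy.
Qed.

Lemma nrm_sig_eq n (u v : signal R n) :
  L1 u -> L1 v -> sig_eq u v -> nrm u = nrm v.
Proof.
move=> [mu_ _] [mv _] uv; rewrite /nrm /norm1; congr fine.
apply: ae_eq_integral => //.
- by apply/measurable_EFinP; exact: measurable_vnorm1.
- by apply/measurable_EFinP; exact: measurable_vnorm1.
- by apply: filterS uv => t /[apply] ->.
Qed.

Lemma nrm_eq0 n (v : signal R n) : L1 v -> nrm v = 0 -> sig_eq v 0.
Proof.
move=> Lv v0; have : (\int[mu]_(t in time) `|(vnorm1 (v t))%:E| = 0)%E.
  rewrite [LHS](_ : _ = norm1 v); first by rewrite norm1E // v0.
  by apply: eq_integral => t _ /=; rewrite ger0_norm.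
have mv : measurable_fun time (EFin \o (fun t => vnorm1 (v t))).
  apply/measurable_EFinP; apply: measurable_vnorm1 => i.
  exact: L1_measurable.
move/(ae_eq_integral_abs mu measurable_time mv).
by apply: filterS => t /[apply] -[] /vnorm1_eq0.
Qed.

(** * Truncation and block signals *)

Lemma truncD n T (u v : signal R n) : trunc T (u + v) = trunc T u + trunc T v.
Proof.
by apply/funext => t; rewrite /trunc !fctE; case: ifP => //; rewrite addr0.
Qed.

Lemma truncZ n T a (u : signal R n) : trunc T (a *: u) = a *: trunc T u.
Proof.
by apply/funext => t; rewrite /trunc !fctE; case: ifP => //; rewrite scaler0.
Qed.

Lemma trunc_trunc n T (u : signal R n) : trunc T (trunc T u) = trunc T u.
Proof. by apply/funext => t; rewrite /trunc; case: ifP => [->|]. Qed.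

Lemma trunc0 n T : trunc T (0 : signal R n) = 0.
Proof. by apply/funext => t; rewrite /trunc; case: ifP. Qed.

Lemma trunc_col n k T (x : signal R n) (y : signal R k) :
  trunc T (col_sig x y) = col_sig (trunc T x) (trunc T y).
Proof.
apply/funext => t; rewrite /trunc /col_sig; case: ifP => // _.
by rewrite col_mx0.
Qed.

Lemma usig_col n k (x : signal R n) (y : signal R k) : usig (col_sig x y) = x.
Proof. by apply/funext => t; rewrite /usig col_mxKu. Qed.

Lemma dsig_col n k (x : signal R n) (y : signal R k) : dsig (col_sig x y) = y.
Proof. by apply/funext => t; rewrite /dsig col_mxKd. Qed.

Lemma col_sigK n k (u : signal R (n + k)) : col_sig (usig u) (dsig u) = u.
Proof. by apply/funext => t; rewrite /col_sig vsubmxK. Qed.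

Lemma col_sigB n k (x x' : signal R n) (y y' : signal R k) :
  col_sig x y - col_sig x' y' = col_sig (x - x') (y - y').
Proof.
by apply/funext => t; rewrite /col_sig !fctE opp_col_mx add_col_mx.
Qed.

Lemma col_sigD n k (x x' : signal R n) (y y' : signal R k) :
  col_sig x y + col_sig x' y' = col_sig (x + x') (y + y').
Proof. by apply/funext => t; rewrite /col_sig !fctE add_col_mx. Qed.

(** * Extended signals, and when they are integrable *)

Lemma L1eD n (u v : signal R n) : L1e u -> L1e v -> L1e (u + v).
Proof.
by move=> Lu Lv T T0; rewrite truncD; apply: L1D; [exact: Lu|exact: Lv].
Qed.

Lemma L1eZ n a (u : signal R n) : L1e u -> L1e (a *: u).
Proof. by move=> Lu T T0; rewrite truncZ; apply: L1Z; exact: Lu. Qed.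

Lemma L1eB n (u v : signal R n) : L1e u -> L1e v -> L1e (u - v).
Proof. by move=> Lu Lv; rewrite -scaleN1r; apply: L1eD => //; exact: L1eZ. Qed.

Lemma L1e0 n : L1e (0 : signal R n).
Proof. by apply: L1_L1e; exact: L10. Qed.

Lemma L1e_col n k (x : signal R n) (y : signal R k) :
  L1e x -> L1e y -> L1e (col_sig x y).
Proof.
by move=> Lx Ly T T0; rewrite trunc_col; apply: L1_col; [exact: Lx|exact: Ly].
Qed.

Lemma L1e_usig n k (v : signal R (n + k)) : L1e v -> L1e (usig v).
Proof.
move=> Lv T T0; have := Lv T T0.
by rewrite -{1}(col_sigK v) trunc_col => /L1_usig; rewrite usig_col.
Qed.

Lemma L1e_dsig n k (v : signal R (n + k)) : L1e v -> L1e (dsig v).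
Proof.
move=> Lv T T0; have := Lv T T0.
by rewrite -{1}(col_sigK v) trunc_col => /L1_dsig; rewrite dsig_col.
Qed.

(** Monotone convergence along the integer truncations, whose pointwise norms increase to that of
    [v]. This is how a bound uniform in time turns an extended signal into an integrable one. *)
Lemma L1_of_bounded_truncations n (v : signal R n) (C : R) : L1e v ->
  (forall T : R, 0 <= T -> nrm (trunc T v) <= C) -> L1 v.
Proof.
move=> Lv vC.
have trn (t : R) : time t ->
    \forall k \near \oo, trunc k%:R v t = v t.
  rewrite /time /= in_itv /= andbT => t0; near=> k.
  rewrite /trunc t0 /=; case: ifPn => //; rewrite -leNgt => kt.
  suff : t < k%:R by move/lt_le_trans => /(_ _ kt); rewrite ltxx.
  by near: k; exact: nbhs_infty_gtr.
(* [L1e] gives measurability of the truncations only; [v] is their pointwise limit. *)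
have mv i : measurable_fun time (fun t => v t i 0).
  apply: (@measurable_fun_cvg _ _ _ _
    (fun k t => trunc k%:R v t i 0)) => [k|t tt].
    by apply: L1_measurable; apply: Lv.
  apply: cvg_near_cst; near=> k; congr (fun_of_matrix _ i 0).
  by near: k; exact: trn.
split=> //.
pose g (k : nat) t := (vnorm1 (trunc k%:R v t))%:E.
have mg k : measurable_fun time (g k).
  apply/measurable_EFinP; apply: measurable_vnorm1 => i.
  by apply: L1_measurable; apply: Lv.
have limg t : time t -> limn (g^~ t) = (vnorm1 (v t))%:E.
  move=> tt; apply/cvg_lim => //; apply: cvg_near_cst; near=> k.
  by rewrite /g; congr (vnorm1 _)%:E; near: k; exact: trn.
have ndg t : time t -> {homo g^~ t : a b / (a <= b)%N >-> (a <= b)%E}.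
  move=> _ a b ab; rewrite /g lee_fin /trunc.
  case: (ifP (0 <= t < a%:R)) => [/andP[-> ta]|_].
    by rewrite /= (lt_le_trans ta) // ler_nat.
  by rewrite vnorm10.
have := @cvg_monotone_convergence _ _ _ mu time measurable_time g mg
  (fun _ _ _ => vnorm1_ge0 _) ndg.
move/cvg_lim => /(_ (@ereal_hausdorff _)).
rewrite [X in _ = X -> _](_ : _ = norm1 v); last first.
  by apply: eq_integral => t; rewrite inE => /limg.
move=> <-; apply: le_lt_trans (ltry C).
apply: lime_le.
  apply: ereal_nondecreasing_is_cvgn => a b ab; apply: ge0_le_integral => //.
  - by move=> t _; rewrite lee_fin.
  - exact: mg.
  - exact: mg.
  - by move=> t tt; exact: (ndg t tt a b ab).
near=> k.
rewrite -[leLHS]/(norm1 (trunc k%:R v)) norm1E ?lee_fin; last exact: Lv.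
exact: vC.
Unshelve. all: by end_near. Qed.

#[local] Instance ae_time_filter : Filter (nbhs (almost_everywhere mu)) :=
  ae_filter_ringOfSetsType mu.

(** Measurability of [v] is supplied by [L1e v]; finiteness of its norm follows from its
    truncations, which have the same norms as those of [u]. *)
Lemma L1_sig_eq n (u v : signal R n) : L1 u -> L1e v -> sig_eq u v -> L1 v.
Proof.
move=> Lu Lv uv; apply: (L1_of_bounded_truncations (C := nrm u)) => // T T0.
rewrite -(@nrm_sig_eq _ (trunc T u)).
- by apply: le_nrm => //; [exact: L1_trunc|exact: vnorm1_trunc].
- exact: L1_trunc.
- exact: Lv.
- exact: sig_eq_trunc.
Qed.

(** * Nonnegative signals and their blocks *)

Lemma sig_le_eq n (u u' v v' : signal R n) :
  sig_eq u u' -> sig_eq v v' -> sig_le u v -> sig_le u' v'.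
Proof.
move=> uu vv uv; have : sig_le u' v.
  by apply: filterS2 uu uv => t eu le tt i; rewrite -eu // le.
by apply: filterS2 vv => t ev le tt i; rewrite -ev // le.
Qed.

Lemma sig_le0_eq n (u v : signal R n) : sig_eq u v -> sig_le 0 u -> sig_le 0 v.
Proof. by apply: sig_le_eq; exact: sig_eq_refl. Qed.

Lemma sig_le0D n (u v : signal R n) :
  sig_le 0 u -> sig_le 0 v -> sig_le 0 (u + v).
Proof.
move=> u0 v0; apply: filterS2 u0 v0 => t u0 v0 tt i.
by rewrite !fctE !mxE addr_ge0 //; [have := u0 tt i|have := v0 tt i]; rewrite mxE.
Qed.

Lemma sig_le0Z n a (u : signal R n) : 0 <= a -> sig_le 0 u -> sig_le 0 (a *: u).
Proof.
move=> a0; apply: filterS => t u0 tt i.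
by rewrite !fctE !mxE mulr_ge0 //; have := u0 tt i; rewrite mxE.
Qed.

Lemma sig_le0_refl n : sig_le (0 : signal R n) 0.
Proof. by apply: aeW => t tt i. Qed.

Lemma sig_le0_trunc n T (u : signal R n) : sig_le 0 u -> sig_le 0 (trunc T u).
Proof.
by apply: filterS => t u0 tt i; rewrite /trunc; case: ifP => // _; exact: u0.
Qed.

Lemma sig_le0_col n k (x : signal R n) (y : signal R k) :
  sig_le 0 x -> sig_le 0 y -> sig_le 0 (col_sig x y).
Proof.
move=> x0 y0; apply: filterS2 x0 y0 => t x0 y0 tt i; rewrite -(splitK i) /col_sig.
case: (fintype.split i) => j /=.
  by rewrite col_mxEu; have := x0 tt j; rewrite !mxE.
by rewrite col_mxEd; have := y0 tt j; rewrite !mxE.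
Qed.

Lemma sig_le0_usig n k (u : signal R (n + k)) : sig_le 0 u -> sig_le 0 (usig u).
Proof.
by apply: filterS => t u0 tt i; have := u0 tt (lshift k i); rewrite !mxE.
Qed.

Lemma sig_le0_dsig n k (u : signal R (n + k)) : sig_le 0 u -> sig_le 0 (dsig u).
Proof.
by apply: filterS => t u0 tt i; have := u0 tt (rshift n i); rewrite !mxE.
Qed.

Lemma nrm_split n k (u : signal R (n + k)) : L1 u ->
  nrm u = nrm (usig u) + nrm (dsig u).
Proof.
by move=> Lu; rewrite -nrm_col ?col_sigK //; [exact: L1_usig|exact: L1_dsig].
Qed.

Lemma usig_trunc n k T (u : signal R (n + k)) :
  usig (trunc T u) = trunc T (usig u).
Proof. by rewrite -{1}(col_sigK u) trunc_col usig_col. Qed.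

Lemma dsig_trunc n k T (u : signal R (n + k)) :
  dsig (trunc T u) = trunc T (dsig u).
Proof. by rewrite -{1}(col_sigK u) trunc_col dsig_col. Qed.

Lemma usigB n k (u v : signal R (n + k)) : usig (u - v) = usig u - usig v.
Proof. by apply/funext => t; rewrite /usig !fctE linearB. Qed.

Lemma dsigB n k (u v : signal R (n + k)) : dsig (u - v) = dsig u - dsig v.
Proof. by apply/funext => t; rewrite /dsig !fctE linearB. Qed.

(** * Integrals of row functionals, as they occur in the conic constraints *)

Lemma integrable_rowmul n (P : 'rV[R]_n) (v : signal R n) :
  L1 v -> mu.-integrable time (EFin \o (fun t => (P *m v t) 0 0)).
Proof.
move=> /L1P Lv.
have : mu.-integrable time
    (fun t => \sum_(j <- index_enum 'I_n) ((P 0 j)%:E * (v t j 0)%:E)%E)%E.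
  by apply: integrable_sum => // j _; apply: integrableZl (Lv j).
by apply: eq_integrable => // t _ /=; rewrite sumEFin mxE.
Qed.

Lemma ler_rowmul n (P : 'rV[R]_n) (x : 'cV[R]_n) :
  (P *m x) 0 0 <= (\sum_j `|P 0 j|) * vnorm1 x.
Proof.
rewrite mxE /vnorm1 mulr_sumr; apply: ler_sum => j _.
rewrite (le_trans (ler_norm _)) // normrM ler_wpM2r //.
by rewrite (bigD1 j) //= lerDl sumr_ge0.
Qed.

Lemma Rintegral_rowmul_le n (P : 'rV[R]_n) (v : signal R n) : L1 v ->
  \int[mu]_(t in time) (P *m v t) 0 0 <= (\sum_j `|P 0 j|) * nrm v.
Proof.
move=> Lv; have iv := L1_integrable_vnorm1 Lv.
rewrite nrmE -RintegralZl //; apply: le_Rintegral => //.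
- exact: integrable_rowmul.
- by apply: eq_integrable (integrableZl measurable_time (\sum_j `|P 0 j|) iv).
- by move=> t _; exact: ler_rowmul.
Qed.

Lemma Rintegral_rowmulB n (P : 'rV[R]_n) (v w : signal R n) : L1 v -> L1 w ->
  \int[mu]_(t in time) (P *m (v - w) t) 0 0 =
  \int[mu]_(t in time) (P *m v t) 0 0 - \int[mu]_(t in time) (P *m w t) 0 0.
Proof.
move=> Lv Lw; rewrite -RintegralB //; last first.
- exact: integrable_rowmul.
- exact: integrable_rowmul.
by apply: eq_Rintegral => t _; rewrite !fctE mulmxBr !mxE.
Qed.

(** On nonnegative signals the entries are their own absolute values; this turns the strictness term
    of [ILCc] into a norm. *)
Lemma Rintegral_ones n (v : signal R n) : L1 v -> sig_le 0 v ->
  \int[mu]_(t in time) ((const_mx 1 : 'rV[R]_n) *m v t) 0 0 = nrm v.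
Proof.
move=> Lv v0; rewrite nrmE /Rintegral; congr fine.
apply: ae_eq_integral => //.
- exact: measurable_int (integrable_rowmul _ Lv).
- exact: measurable_int (L1_integrable_vnorm1 Lv).
apply: filterS v0 => t v0 tt; congr EFin; rewrite mxE; apply: eq_bigr => j _.
by rewrite mxE mul1r ger0_norm //; have := v0 tt j; rewrite mxE.
Qed.

(** * Gains as inequalities between truncated norms *)

Section operator.
Context {n k : nat} (D : signal R n -> signal R k).

Lemma l1e_operatorZ a : l1e_operator D -> l1e_operator (a *: D).
Proof.
move=> [LD DD]; split=> [v Lv|u v Lu Lv uv].
  by apply: L1eZ; exact: LD.
by apply: sig_eqZ; exact: DD.
Qed.

Lemma linear_operatorB u v : linear_operator D -> L1e u -> L1e v ->
  sig_eq (D (u - v)) (D u - D v).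
Proof.
by move=> lD Lu Lv; have := lD (-1) v u Lv Lu; rewrite !scaleN1r ![- _ + _]addrC.
Qed.

(** The supremum defining the gain ranges over inputs with nonzero truncation only. If the
    truncation vanishes, causality and [D 0 = 0] make the truncated output vanish too. *)
Lemma bounded_operatorP : l1e_operator D -> causal D -> sig_eq (D 0) 0 ->
  bounded_operator D ->
  exists2 g, 0 <= g & forall x T, L1e x -> 0 <= T ->
    nrm (trunc T (D x)) <= g * nrm (trunc T x).
Proof.
move=> [LD DD] cD D0 bD.
have [g g0 gain_le] : exists2 g, 0 <= g & (gain_on (@L1e R n) D <= g%:E)%E.
  move: bD; rewrite /bounded_operator; case: gain_on => [r| |] // _.
    by exists `|r|; rewrite // lee_fin ler_norm.
  (* A gain of [-oo] is the supremum of the empty set, as for signals of dimension 0. *)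
  by exists 0; rewrite ?leNye.
exists g => // x T Lx T0.
have LTx := Lx T T0.
have [x0|x0] := eqVneq (nrm (trunc T x)) 0.
  have zero : sig_eq (trunc T (D x)) 0.
    apply: sig_eq_trans (sig_eq_sym (cD T x T0 Lx)) _.
    rewrite -(trunc0 _ T); apply: sig_eq_trunc; apply: sig_eq_trans D0.
    by apply: DD; [exact: L1_L1e|exact: L1e0|exact: nrm_eq0].
  by rewrite x0 mulr0 (nrm_sig_eq _ _ zero) ?nrm0 //; [exact: LD|exact: L10].
(* The gain requires a positive [T]; at [T = 0] the truncation is zero, which is the case already
   treated. *)
have Tgt0 : 0 < T.
  rewrite lt_neqAle T0 andbT eq_sym; apply: contra_neq x0 => ->.
  rewrite (_ : trunc 0 x = 0) ?nrm0 //; apply/funext => t.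
  by rewrite /trunc; case: ifP => // /andP[/le_lt_trans /[apply]]; rewrite ltxx.
rewrite -ler_pdivrMr ?lt_neqAle ?nrm_ge0 1?eq_sym ?x0 // -lee_fin.
apply: le_trans gain_le; apply: ereal_sup_ubound.
exists x, T; split => //; rewrite norm1E // => -[].
by move/eqP; rewrite (negbTE x0).
Qed.

Lemma gain_on_lty (X : set (signal R n)) C : l1e_operator D -> X `<=` @L1e R n ->
  (forall x T, X x -> 0 < T -> nrm (trunc T (D x)) <= C * nrm (trunc T x)) ->
  (gain_on X D < +oo)%E.
Proof.
move=> [LD _] XL DC; apply: le_lt_trans (ltry C).
apply: ge_ereal_sup => _ [x [T [Xx T0 x0 ->]]]; rewrite lee_fin.
have Lx := XL _ Xx T (ltW T0).
rewrite ler_pdivrMr; first exact: DC.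
rewrite lt_neqAle nrm_ge0 andbT eq_sym; apply/eqP => x1; apply: x0.
by rewrite norm1E // /nrm x1.
Qed.

End operator.

(** * Solutions of the loop equations for a fixed pair of operators *)

Section loop.
Context {m p : nat}.
Context (F : signal R m -> signal R p) (G : signal R p -> signal R m).
Hypotheses (LF : l1e_operator F) (LG : l1e_operator G).

Lemma L1e_loop_map u : L1e u -> L1e (loop_map F G u).
Proof.
move=> Lu; have [Lu1 Lu2] := (L1e_usig Lu, L1e_dsig Lu).
by apply: L1e_col; apply: L1eB => //; [apply: LG.1|apply: LF.1].
Qed.

Lemma loop_map_sig_eq u v : L1e u -> L1e v -> sig_eq u v ->
  sig_eq (loop_map F G u) (loop_map F G v).
Proof.
move=> Lu Lv uv; have [uv1 uv2] := (sig_eq_usig uv, sig_eq_dsig uv).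
apply: sig_eq_col; apply: sig_eqB => //.
  by apply: LG.2 => //; exact: L1e_dsig.
by apply: LF.2 => //; exact: L1e_usig.
Qed.

Lemma loop_map_linearB u v : linear_operator F -> linear_operator G ->
  L1e u -> L1e v ->
  sig_eq (loop_map F G (u - v)) (loop_map F G u - loop_map F G v).
Proof.
move=> lF lG Lu Lv; rewrite /loop_map usigB dsigB col_sigB; apply: sig_eq_col.
  have := linear_operatorB lG (L1e_dsig Lu) (L1e_dsig Lv).
  by apply: filterS => t e tt; rewrite !fctE e // !fctE !opprD addrACA.
have := linear_operatorB lF (L1e_usig Lu) (L1e_usig Lv).
by apply: filterS => t e tt; rewrite !fctE e // !fctE !opprD addrACA.
Qed.

(** [u] is a.e. the image under [H] of its own data, and monotonicity compares it with [H 0 = 0]. *)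
Lemma loop_map_le0 u : positive_loop F G -> L1e u ->
  sig_le 0 (loop_map F G u) -> sig_le 0 u.
Proof.
move=> [H [[LH _ HK _] [mH H0]]] Lu u0.
apply: (sig_le_eq H0 (HK u Lu)); apply: mH => //; last exact: L1e0.
exact: L1e_loop_map.
Qed.

(* Moving [d2] through the linear operator [G] turns [(u1, F u1)] into the
   solution of the loop equations with the nonnegative data [(d1 + G d2, 0)];
   this avoids assuming [F] positive. *)
Lemma loop_output_le0 u : positive_loop F G -> linear_operator G ->
  (forall x, L1e x -> sig_le 0 x -> sig_le 0 (G x)) -> L1e u ->
  sig_le 0 (loop_map F G u) -> sig_le 0 (F (usig u)).
Proof.
move=> PFG lG G0 Lu u0.
have [Lu1 Lu2] := (L1e_usig Lu, L1e_dsig Lu); have LFu := LF.1 _ Lu1.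
pose v := col_sig (usig u) (F (usig u)).
have Lv : L1e v by exact: L1e_col.
suff v0 : sig_le 0 (loop_map F G v).
  by have /sig_le0_dsig := loop_map_le0 PFG Lv v0; rewrite dsig_col.
have := u0; rewrite /loop_map => du0.
have := sig_le0_usig du0; have := sig_le0_dsig du0; rewrite usig_col dsig_col.
move=> d20 d10; rewrite usig_col dsig_col; apply: sig_le0_col; last first.
  by rewrite subrr; exact: sig_le0_refl.
(* Linearity gives [d1 + G d2 = u1 - G u2 + G (u2 - F u1) = u1 - G (F u1)]. *)
apply: sig_le0_eq (sig_le0D d10 (G0 _ (L1eB Lu2 LFu) d20)).
have := linear_operatorB lG Lu2 LFu; apply: filterS => t e tt.
by rewrite !fctE e // !fctE addrA subrK.
Qed.

(** The quotient bounds the inverse graph element in terms of the data; the summand 1 pays for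
    passing from that element to [u]. Only [P] and [eps] enter, so the constant is the same for
    every tau. *)
Definition small_gain_const (P : 'rV[R]_(m + p)) (eps : R) : R :=
  1 + (\sum_j `|P 0 j|) / eps.

Lemma small_gain_const_ge0 P eps : 0 < eps -> 0 <= small_gain_const P eps.
Proof.
by move=> e0; rewrite addr_ge0 // divr_ge0 // ?(ltW e0) // sumr_ge0.
Qed.

(* The graph element [v = (u1, F u1)] and the inverse graph element
   [w = (G u2, u2)] differ by [(d1, - d2)]. Hence
   [eps |w| <= - \int P w <= \int P (v - w) <= c |d|]. *)
Lemma L1_loop_bound P eps u : 0 < eps -> ILC P F ->
  (forall w, inv_pgraph G w -> \int[mu]_(t in time) (P *m w t) 0 0 <=
    - eps * \int[mu]_(t in time) ((const_mx 1 : 'rV[R]_(m + p)) *m w t) 0 0) ->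
  L1 u -> L1 (loop_map F G u) ->
  sig_le 0 u -> sig_le 0 (F (usig u)) -> sig_le 0 (G (dsig u)) ->
  nrm u <= small_gain_const P eps * nrm (loop_map F G u).
Proof.
move=> e0 ilcF ilcG Lu Ld u0 F0 G0.
have [Lu1 Lu2] := (L1_usig Lu, L1_dsig Lu).
have [Ld1 Ld2] := (L1_usig Ld, L1_dsig Ld).
set d := loop_map F G u in Ld Ld1 Ld2 *.
have d1E : usig d = usig u - G (dsig u) by rewrite usig_col.
have d2E : dsig d = dsig u - F (usig u) by rewrite dsig_col.
have FE : F (usig u) = dsig u - dsig d by rewrite d2E opprB addrC subrK.
have GE : G (dsig u) = usig u - usig d by rewrite d1E opprB addrC subrK.
have LF1 : L1 (F (usig u)) by rewrite FE; exact: L1B.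
have LG2 : L1 (G (dsig u)) by rewrite GE; exact: L1B.
set v := col_sig (usig u) (F (usig u)); set w := col_sig (G (dsig u)) (dsig u).
have Lv : L1 v by exact: L1_col.
have Lw : L1 w by exact: L1_col.
have v0 : sig_le 0 v by apply: sig_le0_col => //; exact: sig_le0_usig.
have w0 : sig_le 0 w by apply: sig_le0_col => //; exact: sig_le0_dsig.
have Pv : 0 <= \int[mu]_(t in time) (P *m v t) 0 0.
  by apply: ilcF; split; [by split|rewrite usig_col dsig_col; exact: sig_eq_refl].
have Pw : \int[mu]_(t in time) (P *m w t) 0 0 <= - eps * nrm w.
  rewrite -Rintegral_ones //; apply: ilcG; split; first by split.
  by rewrite usig_col dsig_col; exact: sig_eq_refl.
have vwE : v - w = col_sig (usig d) (- dsig d).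
  by rewrite col_sigB d1E d2E opprB.
have nvw : nrm (v - w) = nrm d.
  rewrite vwE nrm_col ?nrmN -?nrm_split //.
  by rewrite -scaleN1r; exact: L1Z.
have := Rintegral_rowmul_le P (L1B Lv Lw).
rewrite Rintegral_rowmulB // nvw => Pvw.
have nw : nrm w <= (\sum_j `|P 0 j|) / eps * nrm d.
  by rewrite mulrAC ler_pdivlMr // mulrC; lra.
(* [w] contains [u2] itself, and [u1 = G u2 + d1]. *)
have nu : nrm u <= nrm w + nrm d.
  rewrite nrm_col // (nrm_split Lu) (nrm_split Ld).
  have : nrm (usig u) <= nrm (G (dsig u)) + nrm (usig d).
    have uE : usig u = G (dsig u) + usig d by rewrite GE subrK.
    by rewrite {1}uE; apply: nrmD.
  by have := nrm_ge0 (dsig d); lra.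
by rewrite /small_gain_const mulrDl mul1r; lra.
Qed.

(** Phrased through solutions rather than an inverse [H], so that the same [u] can be viewed as a
    solution for two values of tau with different data. *)
Definition bounded_solutions (K : R) : Prop :=
  forall u, L1e u -> sig_le 0 (loop_map F G u) ->
  forall T : R, 0 <= T -> nrm (trunc T u) <= K * nrm (trunc T (loop_map F G u)).

Lemma loop_inverse_bounded H K d T : loop_inverse F G H -> bounded_solutions K ->
  L1e d -> sig_le 0 d -> 0 <= T -> nrm (trunc T (H d)) <= K * nrm (trunc T d).
Proof.
move=> [[LH _] _ _ HR] bK Ld d0 T0; have LHd := LH d Ld.
have dH := HR d Ld.
rewrite -(@nrm_sig_eq _ (trunc T (loop_map F G (H d))) (trunc T d)).
- by apply: bK => //; apply: sig_le0_eq d0; exact: sig_eq_sym.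
- by apply: L1e_loop_map.
- exact: Ld.
- exact: sig_eq_trunc.
Qed.

(* Causality reduces the bound on [0, T[ to data in L1, and any a priori bound
   makes the solution integrable, so that the conic constraints apply to it. *)
Lemma bounded_solutions_small_gain P eps K :
  0 < eps -> ILC P F ->
  (forall w, inv_pgraph G w -> \int[mu]_(t in time) (P *m w t) 0 0 <=
    - eps * \int[mu]_(t in time) ((const_mx 1 : 'rV[R]_(m + p)) *m w t) 0 0) ->
  positive_loop F G -> linear_operator G ->
  (forall x, L1e x -> sig_le 0 x -> sig_le 0 (G x)) ->
  bounded_solutions K -> bounded_solutions (small_gain_const P eps).
Proof.
move=> e0 ilcF ilcG PFG lG G0 bK u Lu du0 T T0.
have [H [HI _]] := PFG; have [[LH DH] cH HK HR] := HI.
set d := loop_map F G u in du0 *.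
have Ld : L1e d := L1e_loop_map Lu.
have L1d' : L1 (trunc T d) := Ld T T0.
have Ld' := L1_L1e L1d'.
have d'0 := sig_le0_trunc T du0.
(* The solution for the truncated data has integrable data, and by causality it agrees with [u] on
   [[0, T[]. *)
set u' := H (trunc T d).
have Lu' : L1e u' by exact: LH.
have loopu' : sig_eq (loop_map F G u') (trunc T d) by exact: HR.
have loopu'0 : sig_le 0 (loop_map F G u').
  exact: sig_le0_eq (sig_eq_sym loopu') d'0.
have L1lu' : L1 (loop_map F G u').
  by apply: L1_sig_eq L1d' _ (sig_eq_sym loopu'); exact: L1e_loop_map.
have L1u' : L1 u'.
  (* The absolute value is taken because [K] carries no sign; the a priori bound serves only to
     obtain integrability. *)
  apply: (L1_of_bounded_truncations (C := `|K| * nrm (loop_map F G u'))) => //.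
  move=> S S0; apply: le_trans (bK _ Lu' loopu'0 S S0) _.
  apply: le_trans (ler_wpM2r (nrm_ge0 _) (ler_norm K)) _.
  apply: ler_wpM2l => //; apply: le_nrm => //; first exact: L1_trunc.
  exact: vnorm1_trunc.
have bound : nrm u' <= small_gain_const P eps * nrm (loop_map F G u').
  have u'0 := loop_map_le0 PFG Lu' loopu'0.
  apply: (L1_loop_bound e0) => //; first exact: loop_output_le0.
  by apply: G0; [exact: L1e_dsig|exact: sig_le0_dsig].
rewrite -(nrm_sig_eq L1lu' L1d' loopu'); apply: le_trans bound.
have uu' : sig_eq (trunc T u) (trunc T u').
  apply: sig_eq_trans (sig_eq_sym (cH T d T0 Ld)) => //.
  by apply: sig_eq_trunc; apply: sig_eq_sym; exact: HK.
rewrite (nrm_sig_eq (Lu T T0) (Lu' T T0) uu').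
by apply: le_nrm => //; [exact: Lu'|exact: vnorm1_trunc].
Qed.

(** With [a] the entrywise absolute value of [u], both [u + a] and [a] are nonnegative data, of
    truncated norm at most 2 and 1 times that of [u]; hence the factor 3. *)
Lemma linear_bounded_solutions H K u T :
  linear_operator F -> linear_operator G ->
  loop_inverse F G H -> bounded_solutions K -> 0 <= K -> L1e u -> 0 <= T ->
  nrm (trunc T (H u)) <= K * 3 * nrm (trunc T u).
Proof.
move=> lF lG HI bK K0 Ld T0; have [[LH DH] _ HK HR] := HI.
pose a : signal R (m + p) := fun t => map_mx Num.norm (u t).
have aT S : trunc S a = fun t => map_mx Num.norm (trunc S u t).
  apply/funext => t; rewrite /trunc /a; case: ifP => // _.
  by apply/colP => i; rewrite !mxE normr0.
have La : L1e a by move=> S S0; rewrite aT; apply: L1_absv; exact: Ld.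
have nT : nrm (trunc T a) = nrm (trunc T u).
  rewrite aT !nrmE; apply: eq_Rintegral => t _; apply: eq_bigr => i _.
  by rewrite mxE normr_id.
have a0 : sig_le 0 a by apply: aeW => t _ i; rewrite !mxE.
have Lua := L1eD Ld La.
have ua0 : sig_le 0 (u + a).
  by apply: aeW => t _ i; rewrite !mxE -lerBlDl sub0r ler_normr lexx orbT.
have LHua := LH _ Lua; have LHa := LH _ La.
(* Linearity of the loop map passes to its inverse: the difference of the two solutions solves the
   loop for the data [(u + a) - a = u]. *)
have Hsub : sig_eq (H u) (H (u + a) - H a).
  apply: sig_eq_trans (HK _ (L1eB LHua LHa)); apply: DH => //.
    by apply: L1e_loop_map; exact: L1eB.
  apply: sig_eq_sym; apply: sig_eq_trans (loop_map_linearB lF lG LHua LHa) _.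
  rewrite -[X in sig_eq _ X](addrK a); apply: sig_eqB; exact: HR.
have bua := loop_inverse_bounded HI bK Lua ua0 T0.
have ba := loop_inverse_bounded HI bK La a0 T0.
have LTB := L1eB LHua LHa T0.
rewrite (nrm_sig_eq (LH _ Ld T T0) LTB (sig_eq_trunc T Hsub)).
have -> : trunc T (H (u + a) - H a) = trunc T (H (u + a)) - trunc T (H a).
  by rewrite -scaleN1r truncD truncZ scaleN1r.
have := nrmB (LHua T T0) (LHa T T0).
have : nrm (trunc T (u + a)) <= nrm (trunc T u) + nrm (trunc T u).
  by rewrite truncD -{2}nT; apply: nrmD; [exact: Ld|exact: La].
move: bua ba; rewrite nT; move: (nrm (trunc T (H _))) => x bx.
by move: (nrm (trunc T (H a))) bx => y bx; nra.
Qed.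

End loop.

(** * Varying the gain tau in front of [G1] *)

Section homotopy.
Context {m p : nat}.
Context (G1 : signal R m -> signal R p) (G2 : signal R p -> signal R m).
Hypotheses (LG1 : l1e_operator G1) (LG2 : l1e_operator G2).

Let scale0_apply x : (0 *: G1) x = 0.
Proof. by rewrite scale0r. Qed.

Let scale_apply c x : (c *: G1) x = c *: G1 x.
Proof. by []. Qed.

(** In the open loop the pair [(G2 x, x)] solves the equations with data [(0, x)], so positivity of
    the loop at tau = 0 is positivity of [G2]. *)
Lemma open_loop_positive x : positive_loop (0 *: G1) G2 -> L1e x ->
  sig_le 0 x -> sig_le 0 (G2 x).
Proof.
move=> P0 Lx x0.
have Lu : L1e (col_sig (G2 x) x) by apply: L1e_col => //; exact: LG2.1.
have := loop_map_le0 (l1e_operatorZ 0 LG1) LG2 P0 Lu.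
rewrite /loop_map usig_col dsig_col subrr scale0_apply subr0 => u0.
have /sig_le0_usig := u0 (sig_le0_col (sig_le0_refl _) x0).
by rewrite usig_col.
Qed.

(** The open loop is solved explicitly by [u2 = d2] and [u1 = d1 + G2 d2]. *)
Lemma open_loop_bounded g : 0 <= g ->
  (forall x (T : R), L1e x -> 0 <= T ->
    nrm (trunc T (G2 x)) <= g * nrm (trunc T x)) ->
  bounded_solutions (0 *: G1) G2 (1 + g).
Proof.
move=> g0 hg u Lu _ T T0; set d := loop_map _ _ u.
have Ld : L1e d by apply: L1e_loop_map => //; exact: l1e_operatorZ.
have d1E : usig d = usig u - G2 (dsig u) by rewrite usig_col.
have d2E : dsig d = dsig u by rewrite dsig_col scale0_apply subr0.
have [Lu1 Lu2] := (L1e_usig Lu, L1e_dsig Lu).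
rewrite (nrm_split (Lu T T0)) (nrm_split (Ld T T0)).
rewrite !usig_trunc !dsig_trunc d2E.
have := hg _ _ Lu2 T0.
have : nrm (trunc T (usig u)) <=
    nrm (trunc T (usig d)) + nrm (trunc T (G2 (dsig u))).
  have uE : usig u = usig d + G2 (dsig u) by rewrite d1E subrK.
  rewrite {1}uE truncD; apply: nrmD; first exact: (L1e_usig Ld).
  exact: LG2.1.
have := mulr_ge0 g0 (nrm_ge0 (trunc T (usig d))).
by have := nrm_ge0 (trunc T (dsig u)); lra.
Qed.

(* A solution for the gain [b] is a solution for the smaller gain [a] with the
   extra nonnegative data [(b - a) G1 u1]. *)
Lemma homotopy_step (a b g C : R) : 0 <= C -> 0 <= g -> 0 < b -> a <= b ->
  C * ((b - a) * g) <= 2^-1 ->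
  (forall x (T : R), L1e x -> 0 <= T ->
    nrm (trunc T (G1 x)) <= g * nrm (trunc T x)) ->
  positive_loop (b *: G1) G2 -> linear_operator G2 ->
  (forall x, L1e x -> sig_le 0 x -> sig_le 0 (G2 x)) ->
  bounded_solutions (a *: G1) G2 C -> bounded_solutions (b *: G1) G2 (2 * C).
Proof.
move=> C0 g0 b0 ab small hg Pb lG2 G20 bC u Lu du0 T T0.
have Lu1 := L1e_usig Lu; have LG1u := LG1.1 _ Lu1.
have Lb := l1e_operatorZ b LG1.
set d := loop_map (b *: G1) G2 u in du0 *.
have Ld : L1e d by exact: L1e_loop_map.
pose e : signal R (m + p) := col_sig 0 ((b - a) *: G1 (usig u)).
have Le : L1e e by apply: L1e_col; [exact: L1e0|exact: L1eZ].
have split_d : loop_map (a *: G1) G2 u = d + e.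
  rewrite /d /e /loop_map col_sigD addr0; congr (col_sig _ _).
  by rewrite !scale_apply scalerBl addrA subrK.
have e0 : sig_le 0 e.
  apply: sig_le0_col; first exact: sig_le0_refl.
  have := loop_output_le0 Lb LG2 Pb lG2 G20 Lu du0.
  (* Nonnegativity is available for [b *: G1] applied to [u1]; rescaling by [(b - a) / b] transfers
     it to the extra data. *)
  have k0 : 0 <= (b - a) / b by rewrite divr_ge0 ?subr_ge0 ?(ltW b0).
  move/(sig_le0Z k0); rewrite scale_apply scalerA divfK //.
  by rewrite gt_eqF.
have := bC u Lu; rewrite split_d => /(_ (sig_le0D du0 e0) T T0).
have : nrm (trunc T (d + e)) <= nrm (trunc T d) + nrm (trunc T e).
  by rewrite truncD; apply: nrmD; [exact: Ld|exact: Le].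
have : nrm (trunc T e) <= (b - a) * g * nrm (trunc T u).
  rewrite trunc_col trunc0 truncZ nrm_col; last 2 first.
  - exact: L10.
  - by apply: L1Z; exact: LG1u.
  rewrite nrm0 add0r nrmZ ?ger0_norm ?subr_ge0 //; last exact: LG1u.
  rewrite -mulrA ler_wpM2l ?subr_ge0 //; apply: le_trans (hg _ _ Lu1 T0) _.
  rewrite ler_wpM2l //; last first.
    by rewrite (nrm_split (Lu T T0)) usig_trunc lerDl nrm_ge0.

(* With [x] the truncated norm of [u], the estimate reads [x <= C * (|d| + k * x)] with
   [C * k <= 1/2]; half of [x] is absorbed on the left, which yields the factor 2. *)
move: small (nrm_ge0 (trunc T u)); move: (nrm (trunc T u)) => x.
move: ((b - a) * g) => k small x0 ek de ux.
have : C * (k * x) <= 2^-1 * x by rewrite mulrA ler_wpM2r.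
have := ler_wpM2l C0 de; have := ler_wpM2l C0 ek.
by rewrite !mulrDr; lra.
Qed.

(** Since [H 0 = 0], the zero signal solves the loop with zero data; the second block of its data is
    [- F 0]. *)
Lemma positive_loop_apply0 F : l1e_operator F -> positive_loop F G2 ->
  sig_eq (F 0) 0.
Proof.
move=> LF [H [[[LH _] _ _ HR] [_ H0]]].
have L0 : L1e (0 : signal R (m + p)) by exact: L1e0.
have : sig_eq (loop_map F G2 0) 0.
  apply: sig_eq_trans (HR 0 L0); apply: loop_map_sig_eq => //; first exact: LH.
  exact: sig_eq_sym.
have -> : (0 : signal R (m + p)) = col_sig 0 0.
  by apply/funext => t; rewrite /col_sig col_mx0.
move/sig_eq_dsig; rewrite /loop_map usig_col !dsig_col sub0r => /(sig_eqZ (-1)).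
by rewrite scaler0 scaleN1r opprK.
Qed.

Lemma linear_operator_apply0 : linear_operator G2 -> sig_eq (G2 0) 0.
Proof.
move=> lG2; have := linear_operatorB lG2 (L1e0 p) (L1e0 p).
by rewrite !subrr.
Qed.

End homotopy.

End signals.

(** * Stability from finitely many homotopy steps *)

Theorem theorem5p1 (R : realType) (m p : nat)
    (G1 : signal R m -> signal R p) (G2 : signal R p -> signal R m) :
  l1e_operator G1 -> causal G1 -> bounded_operator G1 ->
  l1e_operator G2 -> linear_operator G2 -> causal G2 -> bounded_operator G2 ->
  (exists Pi : 'rV[R]_(m + p),
    [/\ forall tau : R, 0 <= tau <= 1 ->
          well_posed (tau *: G1) G2 /\ positive_loop (tau *: G1) G2,
        forall tau : R, 0 <= tau <= 1 -> ILC Pi (tau *: G1) &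
        ILCc Pi G2]) ->
  pos_stable G1 G2 /\ (linear_operator G1 -> stable G1 G2).
Proof.
move=> LG1 cG1 bG1 LG2 lG2 cG2 bG2 [P [wp ilc1 [eps e0 ilc2]]].
have pos tau : 0 <= tau <= 1 -> positive_loop (tau *: G1) G2.
  by move=> /wp[].
have pos1 : positive_loop G1 G2.
  by rewrite -[G1]scale1r; apply: pos; rewrite ler01 lexx.
have [g1 g10 hg1] := bounded_operatorP LG1 cG1
  (positive_loop_apply0 LG2 LG1 pos1) bG1.
have [g2 g20 hg2] := bounded_operatorP LG2 cG2
  (linear_operator_apply0 lG2) bG2.
have pos0 : positive_loop (0 *: G1) G2 by apply: pos; rewrite ler01 lexx.
have G2pos x := open_loop_positive LG1 LG2 (x := x) pos0.
pose C := small_gain_const P eps.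
have C0 : 0 <= C := small_gain_const_ge0 P e0.
(* Whatever the bound [K] at tau, it can be replaced by [C]; this keeps the admissible step size
   from shrinking along the homotopy. *)
have upgrade tau K : 0 <= tau <= 1 ->
    bounded_solutions (tau *: G1) G2 K -> bounded_solutions (tau *: G1) G2 C.
  move=> tau01; apply: bounded_solutions_small_gain => //.
  - exact: l1e_operatorZ.
  - exact: ilc1.
  - exact: pos.
(* [N] exceeds [2 * C * g1], so a step of length [1 / N] satisfies the smallness condition
   [C * (g1 / N) <= 1/2]. *)
pose N := (Num.truncn (2 * (C * g1))).+1.
have NC : C * g1 <= 2^-1 * N%:R.
  have : 2 * (C * g1) < N%:R by exact: truncnS_gt.
  by lra.
have N0 : 0 < N%:R :> R by rewrite ltr0n.
have steps k : (k <= N)%N -> bounded_solutions ((k%:R / N%:R) *: G1) G2 C.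
  elim: k => [_|k IH kN].
    rewrite mul0r; apply: (upgrade _ (1 + g2)); first by rewrite ler01 lexx.
    exact: open_loop_bounded.
  (* One step doubles the bound, and the conic constraints bring it back to [C]. *)
  apply: (upgrade _ (2 * C)).
    by rewrite divr_ge0 //= ler_pdivrMr // mul1r ler_nat.
  apply: homotopy_step hg1 _ lG2 G2pos (IH (ltnW kN)) => //.
  - by rewrite divr_gt0 // ltr0n.
  - by rewrite ler_pM2r ?invr_gt0 // ler_nat.
  - rewrite -mulrBl -natrB // subSnn mul1r mulrCA mulrC ler_pdivrMr //.
  - by apply: pos; rewrite divr_ge0 //= ler_pdivrMr // mul1r ler_nat.
have bC : bounded_solutions G1 G2 C.
  have := steps N (leqnn N); rewrite divff ?scale1r // gt_eqF //.
case: pos1 => H [HI Hpos]; have [[LH DH] cH _ _] := HI.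
split=> [|lG1]; exists H; split=> //.
- apply: (gain_on_lty (C := C)) => //.
    by move=> x Lx T T0; have [] := Lx T T0.
  move=> x T Lx T0; have [LTx Tx0] := Lx T (ltW T0).
  have Lxe : L1e x by move=> S S0; have [] := Lx S S0.
  have LTxe : L1e (trunc T x) by exact: L1_L1e.
  (* Membership in [L1ep] gives the sign of [x] on truncations only, so the bound is applied to
     [trunc T x]; causality of [H] then returns to [x]. *)
  have := loop_inverse_bounded LG1 LG2 HI bC LTxe Tx0 (ltW T0).
  rewrite trunc_trunc => /(le_trans _); apply.
  rewrite (nrm_sig_eq _ _ (cH T x (ltW T0) Lxe)) //; apply: LH => //; exact: ltW.
- apply: (gain_on_lty (C := C * 3)) => // x T Lx /ltW T0.
  exact: (linear_bounded_solutions LG1 LG2 lG1 lG2 HI bC C0 Lx T0).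
Qed.
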